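(* Let $Z$ be a metric space, let $X \subset Y \subset Z$ be finite subsets, let $k \geq 0$ be an integer and let $r>0$. Suppose that $L_{s,k}(X)$ and $L_{s,k}(Y)$ are non-empty for $s$ sufficiently large, and that $$d_{H}(X_{dis}^{k+1},Y_{dis}^{k+1}) < r$$ in $Z^{k+1}$. Then there is a system $\theta: L_{s,k}(Y) \to L_{s+2r,k}(X)$, $s \geq 0$, of interleaving maps (as defined in the context) such that, for the induced morphism $\theta_{\ast}: \operatorname{Br}_{k}(Y) \to \operatorname{Br}_{k}(X)$, the diagram of poset morphisms (morphisms of trees) with left and right vertical maps both $i_{\ast}: \operatorname{Br}_{k}(X) \to \operatorname{Br}_{k}(Y)$, top horizontal map $\sigma_{\ast}: \operatorname{Br}_{k}(X) \to \operatorname{Br}_{k}(X)$, bottom horizontal map $\sigma_{\ast}: \operatorname{Br}_{k}(Y) \to \operatorname{Br}_{k}(Y)$ and diagonal map $\theta_{\ast}: \operatorname{Br}_{k}(Y) \to \operatorname{Br}_{k}(X)$ is homotopy commutative. That is, there is a homotopy of poset maps between $\theta_{\ast} i_{\ast}$ and $\sigma_{\ast}: \operatorname{Br}_{k}(X) \to \operatorname{Br}_{k}(X)$, and there is a homotopy of poset maps between $i_{\ast}\theta_{\ast}$ and $\sigma_{\ast}: \operatorname{Br}_{k}(Y) \to \operatorname{Br}_{k}(Y)$.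
   Context: Let $d$ be the metric on $Z$, let $X \subset Z$ be a finite subset, and let $k \geq 0$ be an integer. All distance parameters $s,t,\dots$ are real numbers $\geq 0$. Degree Rips complexes. $V_{s}(X)$ is the simplicial complex whose simplices are the non-empty subsets $\sigma \subset X$ with $d(x,y) \leq s$ for all $x,y \in \sigma$. $L_{s,k}(X)$ is the subcomplex of $V_{s}(X)$ whose simplices are those $\sigma$ such that each vertex $x \in \sigma$ satisfies $d(x,y) \leq s$ for at least $k$ distinct points $y \neq x$ in $X$. For $s \leq t$ there is an inclusion $L_{s,k}(X) \subset L_{t,k}(X)$; for $X \subset Y$ there is an inclusion $i: L_{s,k}(X) \to L_{s,k}(Y)$. The tree $\Gamma_{k}(X)$. This is the poset whose elements (vertices) are the pairs $(s,[x])$ with $s \geq 0$ and $[x] \in \pi_{0}L_{s,k}(X)$ (the path component of a vertex $x$ of $L_{s,k}(X)$), with $(s,[x]) \leq (t,[y])$ if and only if $s \leq t$ and $[x]=[y]$ in $\pi_{0}L_{t,k}(X)$. Branch points. A vertex $(t,[x])$ of $\Gamma_{k}(X)$ is a branch point if either (1) there is an $s_{0}<t$ such that for all $s_{0} \leq s < t$ there are distinct vertices $(s,[x_{0}])$ and $(s,[x_{1}])$ with $(s,[x_{0}]) \leq (t,[x])$ and $(s,[x_{1}]) \leq (t,[x])$; or (2) there is no relation $(s,[y]) \leq (t,[x])$ with $s<t$. $\operatorname{Br}_{k}(X) \subset \Gamma_{k}(X)$ is the subposet of branch points, and $\alpha: \operatorname{Br}_{k}(X) \to \Gamma_{k}(X)$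 is the inclusion. Every vertex $(s,[x])$ of $\Gamma_{k}(X)$ has a unique largest branch point $(s_{0},[x_{0}]) \leq (s,[x])$, called the maximal branch point below $(s,[x])$; the assignment $max(s,[x]) = (s_{0},[x_{0}])$ is a poset map $max: \Gamma_{k}(X) \to \operatorname{Br}_{k}(X)$. A morphism of trees is an order-preserving map. Hausdorff distance. $X^{k+1}_{dis} \subset Z^{k+1}$ is the set of $(k+1)$-tuples of pairwise distinct points of $X$; $Z^{k+1}$ has the product metric $d((z_{j}),(w_{j})) = \max_{j} d(z_{j},w_{j})$, and $d_{H}$ is Hausdorff distance between subsets of $Z^{k+1}$. Interleaving maps. Let $\sigma$ denote the inclusions $L_{s,k}(X) \subset L_{s+2r,k}(X)$ and $L_{s,k}(Y) \subset L_{s+2r,k}(Y)$. A system of interleaving maps is a family of maps of simplicial complexes $\theta: L_{s,k}(Y) \to L_{s+2r,k}(X)$, $s \geq 0$, such that $\theta i = \sigma: L_{s,k}(X) \to L_{s+2r,k}(X)$; $i\theta$ is homotopic to $\sigma: L_{s,k}(Y) \to L_{s+2r,k}(Y)$ (on geometric realizations) by a homotopy which fixes $L_{s,k}(X)$; and the induced functions $\theta: \pi_{0}L_{s,k}(Y) \to \pi_{0}L_{s+2r,k}(X)$ are natural in $s$ (compatible with the functions induced by the inclusions for $s \leq t$). Induced poset maps. The map $i_{\ast}: \operatorname{Br}_{k}(X) \to \operatorname{Br}_{k}(Y)$ is the composite $max \cdot i \cdot \alpha$, where $i: \Gamma_{k}(X) \to \Gamma_{k}(Y)$ is $(s,[x])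 \mapsto (s,[i(x)])$. The map $\theta_{\ast}: \operatorname{Br}_{k}(Y) \to \operatorname{Br}_{k}(X)$ is $max \cdot \theta \cdot \alpha$, where $\theta: \Gamma_{k}(Y) \to \Gamma_{k}(X)$ is $(t,[y]) \mapsto (t+2r,[\theta(y)])$. The map $\sigma_{\ast}: \operatorname{Br}_{k}(X) \to \operatorname{Br}_{k}(X)$ is $max \cdot \sigma \cdot \alpha$, where $\sigma: \Gamma_{k}(X) \to \Gamma_{k}(X)$ is $(s,[x]) \mapsto (s+2r,[x])$, and $\sigma_{\ast}: \operatorname{Br}_{k}(Y) \to \operatorname{Br}_{k}(Y)$ is defined in the same way. Homotopy. A homotopy between poset maps $f,g: P \to Q$ is a pointwise relation between them: $f(p) \leq g(p)$ for all $p \in P$, or $g(p) \leq f(p)$ for all $p \in P$ (such a relation induces a homotopy of maps of nerves). *)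

(* Defs.v *)
From HB Require Import structures.
From mathcomp Require Import all_boot all_order all_algebra finmap.
From mathcomp Require Import all_classical all_reals.
From mathcomp Require Import ereal topology normedtype.
From mathcomp Require Import lra.

Set Implicit Arguments.
Unset Strict Implicit.
Unset Printing Implicit Defensive.

Import Order.TTheory GRing.Theory Num.Theory.
Import numFieldTopology.Exports numFieldNormedType.Exports.

Local Open Scope classical_set_scope.
Local Open Scope ring_scope.

(** * Paths and homotopies inside a subset of a space *)

Section Paths.
Context {R : realType} {T : topologicalType}.
Implicit Types (A : set T) (p q : T).

Definition path_joined A p q := exists gamma : R -> T,
  [/\ {within `[0, 1], continuous gamma},
      forall t : R, 0 <= t <= 1 -> A (gamma t), gamma 0 = p & gamma 1 = q].

Definition path_component A p : set T := [set q | path_joined A p q].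

Lemma path_joined_refl A p : A p -> path_joined A p p.
Proof.
move=> Ap; exists (cst p); split => //.
by apply: continuous_subspaceT => x; exact: cvg_cst.
Qed.

Lemma path_joinedS A B p q : A `<=` B -> path_joined A p q -> path_joined B p q.
Proof. by move=> AB [g [cg Ag g0 g1]]; exists g; split => // t /Ag /AB. Qed.

Lemma within_continuous_comp (A B : set R) (g : R -> T) (h : R -> R) :
  continuous h -> (forall x, A x -> B (h x)) ->
  {within B, continuous g} -> {within A, continuous (g \o h)}.
Proof.
move=> ch hAB /subspace_continuousP cg; apply/subspace_continuousP => x Ax.
apply: (@cvg_comp _ _ _ h g _ (within B (nbhs (h x)))); last exact/cg/hAB.
move=> U /= BU; have := ch x _ BU.
by rewrite /within /= nbhs_simpl /=; apply: filterS => y BUy Ay; apply/BUy/hAB.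
Qed.

Lemma path_joined_sym A p q : path_joined A p q -> path_joined A q p.
Proof.
move=> [g [cg Ag g0 g1]]; exists (g \o (fun t => 1 - t)); split.
- apply: (within_continuous_comp _ _ cg).
    by move=> x; apply: cvgB; [exact: cvg_cst|exact: cvg_id].
  by move=> x /=; rewrite !in_itv/= => x01; lra.
- by move=> t t01; apply: Ag; lra.
- by rewrite /= subr0.
- by rewrite /= subrr.
Qed.

Lemma path_joined_trans A p q u :
  path_joined A p q -> path_joined A q u -> path_joined A p u.
Proof.
move=> [f [cf Af f0 f1]] [g [cg Ag g0 g1]].
pose h t := if t <= 2^-1 then f (2 * t) else g (2 * t - 1).
have i01 : `[0, 1]%classic = `[0, 2^-1]%classic `|` `[2^-1, 1]%classic :> set R.
  apply/seteqP; split => x /=; rewrite !in_itv/=.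
    by case: (leP x 2^-1) => x2 x01; [left|right]; lra.
  by case=> ?; lra.
exists h; split.
- rewrite i01; apply: withinU_continuous; try exact: itv_closed.
    apply: (@subspace_eq_continuous _ _ _ (f \o (fun t => 2 * t))).
      by move=> x; rewrite inE /= in_itv/= => /andP[_ x2]; rewrite /from_subspace /h/= x2.
    apply: (within_continuous_comp _ _ cf).
      by move=> x; apply: cvgM; [exact: cvg_cst|exact: cvg_id].
    by move=> x /=; rewrite !in_itv/= => ?; lra.
  apply: (@subspace_eq_continuous _ _ _ (g \o (fun t => 2 * t - 1))).
    move=> x; rewrite inE /= in_itv/= => /andP[x2 _].
    rewrite /from_subspace /h/=; case: (leP x 2^-1) => // x2'.
    have -> : x = 2^-1 by apply/eqP; rewrite eq_le x2 x2'.
    by rewrite divff ?pnatr_eq0// subrr g0 f1.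
  apply: (within_continuous_comp _ _ cg).
    move=> x; apply: cvgB; last exact: cvg_cst.
    by apply: cvgM; [exact: cvg_cst|exact: cvg_id].
  by move=> x /=; rewrite !in_itv/= => ?; lra.
- move=> t t01; rewrite /h; case: (leP t 2^-1) => t2.
    by apply: Af; lra.
  by apply: Ag; lra.
- by rewrite /h invr_ge0 ler0n mulr0.
- have h1 : ~~ (1 <= 2^-1 :> R) by rewrite -ltNge; lra.
  by rewrite /h ifN// mulr1 (_ : 2 - 1 = 1 :> R)//; lra.
Qed.

Lemma path_component_eq A p q :
  path_joined A p q -> path_component A p = path_component A q.
Proof.
move=> pq; apply/seteqP; split => u /= up.
  exact: path_joined_trans (path_joined_sym pq) up.
exact: path_joined_trans pq up.
Qed.

End Paths.

Arguments path_joined R {T} A p q.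
Arguments path_component R {T} A p.

(** [homotopic_rel A X B f g]: the maps [f] and [g] from [X] to [B] are homotopic
    by a homotopy which is constant on the points of [A]. *)
Definition homotopic_rel (R : realType) {S T : topologicalType}
    (A X : set S) (B : set T) (f g : S -> T) :=
  exists H : S * R -> T,
    [/\ {within X `*` `[0, 1], continuous H},
        forall p (t : R), X p -> 0 <= t <= 1 -> B (H (p, t)),
        forall p, X p -> H (p, 0) = f p /\ H (p, 1) = g p
      & forall p (t : R), A p -> 0 <= t <= 1 -> H (p, t) = f p].

(** * Finite simplicial complexes *)

Record scomplex (V : choiceType) := SComplex {
  simplices :> {fset {fset V}};
  simplex_neq0 : fset0 \notin simplices;
  simplex_sub : forall sigma tau : {fset V}, sigma \in simplices ->
    (tau `<=` sigma)%fset -> tau != fset0 -> tau \in simplices }.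

Lemma scomplex_eq (V : choiceType) (K K' : scomplex V) :
  simplices K = simplices K' -> K = K'.
Proof.
case: K K' => [K a b] [K' a' b'] /= e; rewrite -{}e in a' b' *.
by congr SComplex; exact: Prop_irrelevance.
Qed.

Section Complexes.
Context {R : realType} {V : choiceType}.
Implicit Types (K : scomplex V) (f : V -> V).

Definition vertices K : {fset V} := (\bigcup_(sigma <- K) sigma)%fset.

(** A simplicial map is given by a function on vertices; its values outside of
    the vertices of [K] are irrelevant. *)
Definition simplicial_map K K' f :=
  forall sigma, sigma \in simplices K -> (f @` sigma)%fset \in simplices K'.

(** The geometric realization, in barycentric coordinates. As [K] is finite,
    pointwise convergence induces the usual topology on it. *)
Definition realization K : set {ptws V -> R} :=
  [set w | exists2 sigma, sigma \in simplices K &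
     [/\ forall v, 0 <= w v, forall v, v \notin sigma -> w v = 0
       & \sum_(v <- sigma) w v = 1]].

Definition vertex_point (x : V) : {ptws V -> R} := fun v => (v == x)%:R.

Definition realize K f (w : {ptws V -> R}) : {ptws V -> R} :=
  fun u => \sum_(v <- vertices K | f v == u) w v.

Definition component K (x : V) : set {ptws V -> R} :=
  path_component R (realization K) (vertex_point x).

Definition pi0 K : set (set {ptws V -> R}) :=
  [set component K x | x in [set` vertices K]].

(** The function [[x] |-> [f x]] induced by a simplicial map; the union does
    not depend on the choice of the vertex [x] (see [pi0_mapE]). *)
Definition pi0_map K K' f (C : set {ptws V -> R}) : set {ptws V -> R} :=
  \bigcup_(x in [set x | x \in vertices K /\ C (vertex_point x)])
    component K' (f x).

Lemma verticesP K x : x \in vertices K <-> [fset x]%fset \in simplices K.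
Proof.
split.
  move=> /bigfcupP[sigma /andP[sK _] xs]; apply: simplex_sub sK _ _.
    by rewrite fsub1set.
  by apply/fset0Pn; exists x; rewrite inE.
by move=> xK; apply/bigfcupP; exists [fset x]%fset; rewrite ?xK ?inE.
Qed.

Lemma simplicial_map_vertices K K' f x : simplicial_map K K' f ->
  x \in vertices K -> f x \in vertices K'.
Proof. by move=> fK /verticesP/fK; rewrite imfset_fset1 => /verticesP. Qed.

Lemma realization_vertex K x : x \in vertices K ->
  realization K (vertex_point x).
Proof.
move=> /verticesP xK; exists [fset x]%fset => //; split.
- by move=> v; rewrite /vertex_point ler0n.
- by move=> v; rewrite inE /vertex_point => /negbTE ->.
- by rewrite big_seq_fset1 /vertex_point eqxx.
Qed.

Lemma simplex_vertices K sigma : sigma \in simplices K ->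
  (sigma `<=` vertices K)%fset.
Proof. by move=> sK; apply: bigfcup_sup. Qed.

Lemma realize_vertex K f x : x \in vertices K ->
  realize K f (vertex_point x) = vertex_point (f x).
Proof.
move=> xK; apply/funext => u; rewrite /realize /vertex_point.
rewrite big_mkcond /= (big_fsetD1 x)//= eqxx big1_fset ?addr0.
  by rewrite eq_sym; case: ifP.
by move=> v; rewrite !inE => /andP[/negbTE -> _] _; case: ifP.
Qed.

Lemma ptws_cvg (F : set_system {ptws V -> R}) (w : {ptws V -> R}) : Filter F ->
  (forall v, (fun w' : {ptws V -> R} => w' v) @ F --> w v) -> F --> w.
Proof.
move=> FF cF; apply/cvg_sup => v U [B [[W oW <-] Ww WU]].
by apply: filterS WU _; apply: (cF v); exact: open_nbhs_nbhs.
Qed.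

Lemma ptws_continuous (f : {ptws V -> R} -> {ptws V -> R}) :
  (forall v, continuous (fun w : {ptws V -> R} => f w v : R)) -> continuous f.
Proof.
move=> cf w; have FF : Filter (f @ nbhs w).
  by refine (@fmap_filter _ _ f (nbhs w) _).
by refine (ptws_cvg FF _) => v; refine (cf v w).
Qed.

Lemma realize_continuous K f : continuous (realize K f).
Proof.
apply: ptws_continuous => u w.
have cw v : (fun w' : {ptws V -> R} => w' v) @ w --> w v.
  exact: (@proj_continuous V (fun=> R) v w).
have cadd : continuous (fun x : R * R => x.1 + x.2).
  by move=> x; apply: cvgD; [exact: cvg_fst|exact: cvg_snd].
refine (@cvg_big R V +%R 0 (fun v => f v == u) cadd _ (nbhs w) (vertices K)
  (fun v (w' : {ptws V -> R}) => w' v) w _ (fun v _ => cw v)).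
Qed.

Lemma realize_realization K K' f w : simplicial_map K K' f ->
  realization K w -> realization K' (realize K f w).
Proof.
move=> fK [sigma sK [w0 wout w1]]; exists (f @` sigma)%fset; first exact: fK.
have sub := simplex_vertices sK.
have realizeE u : realize K f w u = \sum_(v <- sigma | f v == u) w v.
  rewrite /realize big_mkcond [RHS]big_mkcond /=.
  apply/esym; apply: (big_fset_incl _ sub) => v vK vs.
  by rewrite (wout v vs); case: ifP.
split.
- by move=> u; rewrite realizeE; apply: sumr_ge0 => v _; exact: w0.
- move=> u uf; rewrite realizeE big_seq_cond big1// => v /andP[vs /eqP fvu].
  by move: uf; rewrite -fvu in_imfset.
- under eq_bigr do rewrite realizeE.
  rewrite -[RHS]w1 (exchange_big_dep predT)//= big_seq [RHS]big_seq.
  apply: eq_bigr => v vs.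
  have fvs : f v \in (f @` sigma)%fset by rewrite in_imfset.
  rewrite big_mkcond (big_fsetD1 (f v))//= eqxx big1_fset ?addr0//.
  by move=> u; rewrite !inE eq_sym => /andP[/negbTE -> _].
Qed.

Lemma component_vertex K x : x \in vertices K -> component K x (vertex_point x).
Proof. by move=> xK; apply/path_joined_refl/realization_vertex. Qed.

Lemma pi0_component K x : x \in vertices K -> pi0 K (component K x).
Proof. by move=> xK; exists x. Qed.

Lemma pi0_mapE K K' f x : simplicial_map K K' f -> x \in vertices K ->
  pi0_map K K' f (component K x) = component K' (f x).
Proof.
move=> fK xK; apply/seteqP; split => [p|p xp]; last first.
  by exists x => //; split => //; exact: component_vertex.
case=> y [yK [g [cg gK g0 g1]]]; rewrite /component.
rewrite (@path_component_eq R _ _ (vertex_point (f x)) (vertex_point (f y)))//.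
exists (realize K f \o g); split.
- move=> t; refine (@continuous_comp (subspace _) _ _ g (realize K f) t (cg t) _).
  by refine (@realize_continuous K f _).
- by move=> t /gK gt; exact: realize_realization fK gt.
- by rewrite /= g0 realize_vertex.
- by rewrite /= g1 realize_vertex.
Qed.

Lemma pi0_map_pi0 K K' f C : simplicial_map K K' f ->
  pi0 K C -> pi0 K' (pi0_map K K' f C).
Proof.
move=> fK [x xK <-]; rewrite pi0_mapE//; apply: pi0_component.
exact: simplicial_map_vertices fK xK.
Qed.

Lemma simplicial_map_comp K K' K'' f g : simplicial_map K K' f ->
  simplicial_map K' K'' g -> simplicial_map K K'' (g \o f).
Proof. by move=> fK gK sigma /fK/gK; rewrite -imfset_comp. Qed.

Lemma pi0_map_comp K K' K'' f g C : simplicial_map K K' f ->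
  simplicial_map K' K'' g -> pi0 K C ->
  pi0_map K' K'' g (pi0_map K K' f C) = pi0_map K K'' (g \o f) C.
Proof.
move=> fK gK [x xK <-]; have fxK := simplicial_map_vertices fK xK.
by rewrite (pi0_mapE fK xK) (pi0_mapE gK fxK) pi0_mapE//; exact: simplicial_map_comp fK gK.
Qed.

Lemma simplicial_map_id K K' : (simplices K `<=` simplices K')%fset ->
  simplicial_map K K' id.
Proof. by move=> KK' s /(fsubsetP KK'); rewrite imfset_id. Qed.

Lemma pi0_map_id K C : pi0 K C -> pi0_map K K id C = C.
Proof. by move=> [x xK <-]; rewrite pi0_mapE//; exact: simplicial_map_id. Qed.

End Complexes.

Arguments realization R {V} K.
Arguments realize R {V} K f w.

(** * Degree Rips complexes *)

Section DegreeRips.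
Context {R : realType} {Z : metricType R}.
Implicit Types (s t : R) (k : nat) (X Y : {fset Z}).

Definition rips_simplices s X : {fset {fset Z}} :=
  [fset sigma in fpowerset X |
    (sigma != fset0) && all2rel (fun x y => mdist x y <= s) sigma]%fset.

Definition neighbors s X (x : Z) : {fset Z} :=
  [fset y in X | (y != x) && (mdist x y <= s)]%fset.

Definition degree_rips_simplices s k X : {fset {fset Z}} :=
  [fset sigma in rips_simplices s X |
    all (fun x => (k <= #|` neighbors s X x|)%N) sigma]%fset.

Lemma rips_simplicesP s X (sigma : {fset Z}) :
  reflect [/\ (sigma `<=` X)%fset, sigma != fset0 &
            {in sigma &, forall x y, mdist x y <= s}]
          (sigma \in rips_simplices s X).
Proof.
rewrite !inE fpowersetE; apply: (iffP and3P) => -[-> -> h]; split => //.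
  by move=> x y xs ys; exact: (allrelP h).
by apply/allrelP => x y xs ys; exact: h.
Qed.

Lemma degree_rips_simplicesP s k X (sigma : {fset Z}) :
  reflect [/\ (sigma `<=` X)%fset, sigma != fset0,
            {in sigma &, forall x y, mdist x y <= s} &
            {in sigma, forall x, (k <= #|` neighbors s X x|)%N}]
          (sigma \in degree_rips_simplices s k X).
Proof.
rewrite inE /=; apply: (iffP andP) => [[/rips_simplicesP[a b c] /allP]|[a b c d]].
  by [].
by split; [exact/rips_simplicesP|exact/allP].
Qed.

Lemma rips_neq0 s X : fset0 \notin rips_simplices s X.
Proof. by apply/negP => /rips_simplicesP[_ /eqP]. Qed.

Lemma rips_sub s X (sigma tau : {fset Z}) : sigma \in rips_simplices s X ->
  (tau `<=` sigma)%fset -> tau != fset0 -> tau \in rips_simplices s X.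
Proof.
move=> /rips_simplicesP[sX _ sd] ts t0; apply/rips_simplicesP; split => //.
  exact: fsubset_trans ts sX.
by move=> x y xt yt; apply: sd; exact: (fsubsetP ts).
Qed.

Definition rips s X : scomplex Z := SComplex (rips_neq0 s X) (@rips_sub s X).

Lemma degree_rips_neq0 s k X : fset0 \notin degree_rips_simplices s k X.
Proof. by apply/negP => /degree_rips_simplicesP[_ /eqP]. Qed.

Lemma degree_rips_sub s k X (sigma tau : {fset Z}) :
  sigma \in degree_rips_simplices s k X ->
  (tau `<=` sigma)%fset -> tau != fset0 -> tau \in degree_rips_simplices s k X.
Proof.
move=> /degree_rips_simplicesP[sX _ sd sk] ts t0.
apply/degree_rips_simplicesP; split => //.
- exact: fsubset_trans ts sX.
- by move=> x y xt yt; apply: sd; exact: (fsubsetP ts).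
- by move=> x xt; apply: sk; exact: (fsubsetP ts).
Qed.

Definition degree_rips s k X : scomplex Z :=
  SComplex (degree_rips_neq0 s k X) (@degree_rips_sub s k X).

Lemma neighbors_le s t X Y x : s <= t -> (X `<=` Y)%fset ->
  (neighbors s X x `<=` neighbors t Y x)%fset.
Proof.
move=> st XY; apply/fsubsetP => y; rewrite !inE => /and3P[/(fsubsetP XY)-> -> /=].
by move=> /le_trans; apply.
Qed.

Lemma degree_rips_le s t k X Y : s <= t -> (X `<=` Y)%fset ->
  (simplices (degree_rips s k X) `<=` simplices (degree_rips t k Y))%fset.
Proof.
move=> st XY; apply/fsubsetP => sigma /degree_rips_simplicesP[sX s0 sd sk].
apply/degree_rips_simplicesP; split => //.
- exact: fsubset_trans sX XY.
- by move=> x y xs ys; apply: le_trans (sd _ _ xs ys) st.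
- by move=> x xs; apply: leq_trans (sk x xs) _; exact/fsubset_leq_card/neighbors_le.
Qed.

Lemma degree_rips_incl s t k X Y : s <= t -> (X `<=` Y)%fset ->
  simplicial_map (degree_rips s k X) (degree_rips t k Y) id.
Proof. by move=> st XY; exact/simplicial_map_id/degree_rips_le. Qed.

End DegreeRips.

(** * The tree of path components *)

Fact tree_display : Order.disp_t. Proof. exact: Order.Disp tt tt. Qed.

Section Tree.
Context {R : realType} {Z : metricType R}.
Implicit Types (s t : R) (k : nat) (X Y : {fset Z}).

Record Gamma k X := MkGamma {
  height : R;
  class : set {ptws Z -> R};
  height_ge0 : 0 <= height;
  classP : pi0 (degree_rips height k X) class }.

HB.instance Definition _ k X := gen_eqMixin (Gamma k X).
HB.instance Definition _ k X := gen_choiceMixin (Gamma k X).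

Lemma Gamma_eq k X (g h : Gamma k X) :
  height g = height h -> class g = class h -> g = h.
Proof.
case: g h => [s C s0 CP] [t D t0 DP] /= e f; rewrite -{}e -{}f in t0 DP *.
by congr MkGamma; exact: Prop_irrelevance.
Qed.

Definition le_Gamma k X (g h : Gamma k X) : bool :=
  (height g <= height h) &&
  `[< pi0_map (degree_rips (height g) k X) (degree_rips (height h) k X) id
        (class g) = class h >].

Lemma le_GammaP k X (g h : Gamma k X) :
  reflect (height g <= height h /\
    pi0_map (degree_rips (height g) k X) (degree_rips (height h) k X) id
      (class g) = class h) (le_Gamma g h).
Proof. by apply: (iffP andP) => -[? /asboolP ?]. Qed.

Lemma pi0_map_incl2 s t u k X Y W (C : set {ptws Z -> R}) : s <= t -> t <= u ->
  (X `<=` Y)%fset -> (Y `<=` W)%fset -> pi0 (degree_rips s k X) C ->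
  pi0_map (degree_rips t k Y) (degree_rips u k W) id
    (pi0_map (degree_rips s k X) (degree_rips t k Y) id C) =
  pi0_map (degree_rips s k X) (degree_rips u k W) id C.
Proof.
move=> st tu XY YW CP; by rewrite pi0_map_comp//; exact: degree_rips_incl.
Qed.

Lemma le_Gamma_refl k X : reflexive (@le_Gamma k X).
Proof. by move=> g; apply/le_GammaP; split => //; exact/pi0_map_id/classP. Qed.

Lemma le_Gamma_anti k X : antisymmetric (@le_Gamma k X).
Proof.
move=> g h /andP[/le_GammaP[gh e] /le_GammaP[hg _]].
have hh : height g = height h by apply/eqP; rewrite eq_le gh hg.
apply: Gamma_eq => //; rewrite -e -hh pi0_map_id//; exact: classP.
Qed.

Lemma le_Gamma_trans k X : transitive (@le_Gamma k X).
Proof.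
move=> h g i /le_GammaP[gh e] /le_GammaP[hi e']; apply/le_GammaP; split.
  exact: le_trans gh hi.
by rewrite -e' -e pi0_map_incl2//; exact: classP.
Qed.

HB.instance Definition _ k X := Order.Le_isPOrder.Build tree_display (Gamma k X)
  (@le_Gamma_refl k X) (@le_Gamma_anti k X) (@le_Gamma_trans k X).

Local Open Scope order_scope.

Definition branch_point k X (g : Gamma k X) : Prop :=
  (exists s0 : R, [/\ (0 <= s0)%R, (s0 < height g)%R &
     forall s : R, (s0 <= s < height g)%R ->
       exists h0 h1 : Gamma k X, [/\ height h0 = s, height h1 = s,
         h0 <> h1, h0 <= g & h1 <= g]]) \/
  ~ (exists h : Gamma k X, (height h < height g)%R /\ h <= g).

Definition Br k X := {g : Gamma k X | `[< branch_point g >]}.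

HB.instance Definition _ k X := SubType.on (Br k X).
HB.instance Definition _ k X := Choice.on (Br k X).
HB.instance Definition _ k X :=
  [SubChoice_isSubPOrder of Br k X by <: with tree_display].

Definition is_max_branch k X (g : Gamma k X) (b : Br k X) :=
  val b <= g /\ forall b' : Br k X, val b' <= g -> b' <= b.

(** The complexes [degree_rips s k X] only change when [s] crosses one of the
    finitely many distances between points of [X]. *)
Definition criticals X : seq R := 0%R :: [seq mdist x y | x <- X, y <- X].

Definition last_critical X t : R := \big[Num.max/0%R]_(c <- criticals X | (c <= t)%R) c.

Lemma last_critical_ge X t (c : R) : c \in criticals X -> (c <= t)%R ->
  (c <= last_critical X t)%R.
Proof. by move=> cX ct; apply: (le_bigmax_seq _ _ _ id cX). Qed.

Lemma last_critical_mem X t : last_critical X t \in criticals X.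
Proof.
rewrite /last_critical big_seq_cond.
elim/big_ind: _ => [|x y xc yc|c /andP[]//]; first by rewrite inE eqxx.
by rewrite /Num.max; case: ifP.
Qed.

Lemma last_critical_ge0 X t : (0 <= last_critical X t)%R.
Proof. exact: bigmax_ge_id. Qed.

Lemma last_critical_le X t : (0 <= t)%R -> (last_critical X t <= t)%R.
Proof. by move=> t0; apply: bigmax_le. Qed.

Lemma degree_rips_const s t k X : (0 <= s <= t)%R ->
  (last_critical X t <= s)%R -> degree_rips s k X = degree_rips t k X.
Proof.
move=> /andP[s0 st] cs.
have dE x y : x \in X -> y \in X -> (mdist x y <= s)%R = (mdist x y <= t)%R.
  move=> xX yX; apply/idP/idP => [/le_trans->//|xyt].
  apply: le_trans _ cs; apply: last_critical_ge => //.
  by rewrite inE; apply/orP; right; apply: allpairs_f.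
have nE x : x \in X -> neighbors s X x = neighbors t X x.
  move=> xX; apply/fsetP => y; rewrite !inE; case yX : (y \in X) => //=.
  by rewrite dE.
apply: scomplex_eq; apply/fsetP => sigma.
apply/degree_rips_simplicesP/degree_rips_simplicesP => -[sX s1 sd sk]; split => //.
- by move=> x y xs ys; rewrite -dE ?(fsubsetP sX)//; exact: sd.
- by move=> x xs; rewrite -nE ?(fsubsetP sX)//; exact: sk.
- by move=> x y xs ys; rewrite dE ?(fsubsetP sX)//; exact: sd.
- by move=> x xs; rewrite nE ?(fsubsetP sX)//; exact: sk.
Qed.

Lemma Gamma_leP k X (g h : Gamma k X) :
  (g <= h) <-> ((height g <= height h)%R /\
    pi0_map (degree_rips (height g) k X) (degree_rips (height h) k X) id
      (class g) = class h).
Proof. by split => [/le_GammaP|?]; last exact/le_GammaP. Qed.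

Lemma pi0_map_const s t k X (C : set {ptws Z -> R}) : degree_rips s k X = degree_rips t k X ->
  pi0 (degree_rips s k X) C ->
  pi0_map (degree_rips s k X) (degree_rips t k X) id C = C.
Proof. by move=> <-; exact: pi0_map_id. Qed.

(** Any vertex can be moved down to the previous critical value. *)
Lemma ex_drop k X (g : Gamma k X) s : (0 <= s <= height g)%R ->
  (last_critical X (height g) <= s)%R ->
  exists h : Gamma k X, [/\ height h = s, h <= g & forall b, b <= g ->
    (height b <= s)%R -> b <= h].
Proof.
move=> sg cs; have E := degree_rips_const k sg cs.
have CP : pi0 (degree_rips s k X) (class g) by rewrite E; exact: classP.
have /andP[s0 sle] := sg.
exists (MkGamma s0 CP); split => //.
  by apply/Gamma_leP; split => //=; rewrite pi0_map_const.
by move=> b /Gamma_leP[_ e] bs; apply/Gamma_leP; split => //=; rewrite E e.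
Qed.

Lemma ex_lift k X (g h : Gamma k X) s : g <= h ->
  (height g <= s <= height h)%R ->
  exists i : Gamma k X, [/\ height i = s, g <= i & i <= h].
Proof.
move=> /Gamma_leP[gh e] /andP[gs sh].
have CP := pi0_map_pi0 (degree_rips_incl (k := k) gs (fsubset_refl X)) (classP g).
exists (MkGamma (le_trans (height_ge0 g) gs) CP).
split => //; apply/Gamma_leP; split => //=.
by rewrite -e pi0_map_incl2//; exact: classP.
Qed.

Lemma Gamma_le_eq k X (g h : Gamma k X) : g <= h -> height g = height h -> g = h.
Proof.
move=> /Gamma_leP[_ e] gh; apply: Gamma_eq => //; rewrite -e -gh pi0_map_id//.
exact: classP.
Qed.

Lemma branch_point_critical k X (g : Gamma k X) : branch_point g ->
  height g \in criticals X.
Proof.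
move=> bg; have t0 := height_ge0 g.
have := last_critical_le X t0; rewrite le_eqVlt => /orP[/eqP <-|ct].
  exact: last_critical_mem.
have c0 := last_critical_ge0 X (height g).
case: bg => [[s0 [s00 s0t H]]|[]]; last first.
  have [|h [hc hg _]] := @ex_drop _ _ g (last_critical X (height g)) _ (lexx _).
    by rewrite c0 ltW.
  by exists h; rewrite hc.
pose s := Num.max s0 (last_critical X (height g)).
have st : (s < height g)%R by rewrite gt_max s0t ct.
have [|h0 [h1 [e0 e1 ne l0 l1]]] := H s; first by rewrite le_max lexx st.
have cs : (last_critical X (height g) <= s)%R by rewrite le_max lexx orbT.
have [|h [hs _ hmax]] := @ex_drop _ _ g s _ cs.
  by rewrite (le_trans c0 cs) ltW.
exfalso; apply: ne; transitivity h.
  by apply: Gamma_le_eq; [apply: hmax => //; rewrite e0|rewrite e0].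
by apply/esym/Gamma_le_eq; [apply: hmax => //; rewrite e1|rewrite e1].
Qed.

Lemma ex_max_branch k X (g : Gamma k X) : exists b : Br k X, is_max_branch g b.
Proof.
pose N (h : Gamma k X) := count (fun c => (c <= height h)%R) (criticals X).
have crit_case n : forall h : Gamma k X, (N h < n)%N ->
    height h \in criticals X -> exists b : Br k X, is_max_branch h b.
  elim: n => // n IHn h hn hc.
  have [bh|nbh] := pselect (branch_point h).
    exists (Sub h (asboolT bh)); split; first by rewrite SubK.
    by move=> b' b'h; exact: b'h.
  have [h0 [h0h h0le]] : exists i : Gamma k X, (height i < height h)%R /\ i <= h.
    by apply: contrapT => ne; apply: nbh; right.
  pose m := \big[Num.max/height h0]_(c <- criticals X | (c < height h)%R) c.
  have m0 : (height h0 <= m)%R by exact: bigmax_ge_id.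
  have mh : (m < height h)%R by exact: bigmax_lt.
  have [s [ms sh uniq]] : exists s, [/\ (m <= s)%R, (s < height h)%R &
      forall i j : Gamma k X, height i = s -> height j = s ->
        i <= h -> j <= h -> i = j].
    apply: contrapT => ne; apply: nbh; left; exists m; split => //.
      exact: le_trans (height_ge0 h0) m0.
    move=> s /andP[ms sh]; apply: contrapT => ne2; apply: ne; exists s.
    split => // i j si sj ih jh; apply: contrapT => ij; apply: ne2.
    by exists i, j.
  have [|u [us _ uh]] := ex_lift (s := s) h0le.
    by rewrite (le_trans m0 ms) ltW.
  have s0 : (0 <= s)%R by rewrite -us height_ge0.
  have [||d [dc du dmax]] := @ex_drop _ _ u (last_critical X s) _ _.
  - by rewrite last_critical_ge0 us last_critical_le.
  - by rewrite us.
  have [||b [bd bmax]] := IHn d.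
  - rewrite ltnS in hn; apply: leq_trans hn; rewrite /N.
    have -> : count (fun c => (c <= height h)%R) (criticals X) =
        (count (fun c => (c <= height d)%R) (criticals X) +
         count (fun c => (height d < c <= height h)%R) (criticals X))%N.
      rewrite -count_predUI [X in (_ + X)%N](_ : _ = 0)%N ?addn0; last first.
        apply/eqP; rewrite -leqn0 leqNgt -has_count; apply/hasPn => c _ /=.
        by case: (leP c).
      apply: eq_count => c /=; case: (leP c (height d)) => //= cd.
      apply: le_trans cd _; rewrite dc (le_trans (last_critical_le _ s0))//.
      exact: ltW.
    rewrite -addn1 leq_add2l -has_count; apply/hasP; exists (height h) => //=.
    by rewrite lexx andbT dc (le_lt_trans (last_critical_le _ s0)).
  - by rewrite dc last_critical_mem.
  exists b; split; first exact: le_trans bd (le_trans du uh).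
  move=> b' b'h; apply: bmax.
  have b'c := branch_point_critical (asboolW (valP b')).
  have b'lt : (height (val b') < height h)%R.
    have /Gamma_leP[+ _] := b'h; rewrite le_eqVlt => /orP[/eqP e|//].
    have be := Gamma_le_eq b'h e.
    by exfalso; apply: nbh; rewrite -be; exact: asboolW (valP b').
  have b's : (height (val b') <= s)%R.
    by apply: le_trans _ ms; apply: (le_bigmax_seq _ _ _ id b'c).
  apply: dmax; last by apply: last_critical_ge.
  have [|v [vs b'v vh]] := ex_lift (s := s) b'h; first by rewrite b's ltW.
  by rewrite -(uniq _ _ vs us vh uh).
have [|d [dc dg dmax]] := @ex_drop _ _ g (last_critical X (height g)) _ (lexx _).
  by rewrite last_critical_ge0 last_critical_le ?height_ge0.
have [|b [bd bmax]] := crit_case (N d).+1 d (leqnn _).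
  by rewrite dc last_critical_mem.
exists b; split; first exact: le_trans bd dg.
move=> b' b'g; apply: bmax; apply: dmax => //; apply: last_critical_ge.
  exact: branch_point_critical (asboolW (valP b')).
by have /Gamma_leP[] := b'g.
Qed.

Lemma is_max_branch_unique k X (g : Gamma k X) (b b' : Br k X) :
  is_max_branch g b -> is_max_branch g b' -> b = b'.
Proof.
by move=> [bg bm] [b'g b'm]; apply/le_anti; rewrite b'm// bm.
Qed.

Definition max_branch k X (g : Gamma k X) : Br k X := sval (cid (ex_max_branch g)).

Lemma max_branchP k X (g : Gamma k X) : is_max_branch g (max_branch g).
Proof. exact: svalP (cid (ex_max_branch g)). Qed.

Lemma max_branch_homo k X : {homo @max_branch k X : g h / g <= h}.
Proof.
move=> g h gh; have [bg _] := max_branchP g; have [_] := max_branchP h; apply.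
exact: le_trans bg gh.
Qed.

HB.instance Definition _ k X := Order.isOrderMorphism.Build
  tree_display (Gamma k X) tree_display (Br k X) (@max_branch k X)
  (@max_branch_homo k X).

End Tree.

(** * Maps between trees *)

Section TreeMaps.
Context {R : realType} {Z : metricType R}.
Implicit Types (r s t : R) (k : nat) (X Y : {fset Z}).

(** A system of interleaving maps [degree_rips s k Y -> degree_rips (s + 2 r) k X].
    The underlying function of [i theta] is that of [theta]; on vertices,
    inclusions are the identity. *)
Record interleaving r k X Y := Interleaving {
  imap :> R -> Z -> Z;
  imap_simplicial : forall s, 0 <= s ->
    simplicial_map (degree_rips s k Y) (degree_rips (s + 2 * r) k X) (imap s);
  imap_incl : forall s x, 0 <= s ->
    x \in vertices (degree_rips s k X) -> imap s x = x;
  imap_homotopic : forall s, 0 <= s ->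
    homotopic_rel R (realization R (degree_rips s k X))
      (realization R (degree_rips s k Y))
      (realization R (degree_rips (s + 2 * r) k Y))
      (realize R (degree_rips s k Y) (imap s)) (realize R (degree_rips s k Y) id);
  imap_natural : forall s t (C : set {ptws Z -> R}), 0 <= s -> s <= t ->
    pi0 (degree_rips s k Y) C ->
    pi0_map (degree_rips (s + 2 * r) k X) (degree_rips (t + 2 * r) k X) id
      (pi0_map (degree_rips s k Y) (degree_rips (s + 2 * r) k X) (imap s) C) =
    pi0_map (degree_rips t k Y) (degree_rips (t + 2 * r) k X) (imap t)
      (pi0_map (degree_rips s k Y) (degree_rips t k Y) id C) }.

Lemma shift_ge0 r s : 0 < r -> 0 <= s -> 0 <= s + 2 * r.
Proof. by move=> r0 s0; rewrite addr_ge0// mulr_ge0// ltW. Qed.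

Lemma shift_ge r s : 0 < r -> s <= s + 2 * r.
Proof. by move=> r0; rewrite lerDl mulr_ge0// ltW. Qed.

Definition incl_Gamma k X Y (XY : (X `<=` Y)%fset) (g : Gamma k X) : Gamma k Y :=
  MkGamma (height_ge0 g)
    (pi0_map_pi0 (degree_rips_incl (lexx (height g)) XY) (classP g)).

Definition shift_Gamma r (r0 : 0 < r) k X (g : Gamma k X) : Gamma k X :=
  MkGamma (shift_ge0 r0 (height_ge0 g))
    (pi0_map_pi0 (degree_rips_incl (shift_ge (height g) r0) (fsubset_refl X))
       (classP g)).

Definition interleaving_Gamma r (r0 : 0 < r) k X Y (theta : interleaving r k X Y)
    (g : Gamma k Y) : Gamma k X :=
  MkGamma (shift_ge0 r0 (height_ge0 g))
    (pi0_map_pi0 (imap_simplicial theta (height_ge0 g)) (classP g)).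

Lemma incl_Gamma_homo k X Y (XY : (X `<=` Y)%fset) :
  {homo @incl_Gamma k X Y XY : g h / (g <= h)%O}.
Proof.
move=> g h /Gamma_leP[gh e]; apply/Gamma_leP; split => //=.
by rewrite -e !pi0_map_incl2//; exact: classP.
Qed.

Lemma shift_Gamma_homo r (r0 : 0 < r) k X :
  {homo @shift_Gamma r r0 k X : g h / (g <= h)%O}.
Proof.
move=> g h /Gamma_leP[gh e]; apply/Gamma_leP; split => /=; first by rewrite lerD2r.
by rewrite -e !pi0_map_incl2// ?shift_ge ?lerD2r//; exact: classP.
Qed.

Lemma interleaving_Gamma_homo r (r0 : 0 < r) k X Y (theta : interleaving r k X Y) :
  {homo interleaving_Gamma r0 theta : g h / (g <= h)%O}.
Proof.
move=> g h /Gamma_leP[gh e]; apply/Gamma_leP; split => /=; first by rewrite lerD2r.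
by rewrite -e; apply: imap_natural => //; [exact: height_ge0|exact: classP].
Qed.

HB.instance Definition _ k X Y (XY : (X `<=` Y)%fset) :=
  Order.isOrderMorphism.Build tree_display (Gamma k X) tree_display (Gamma k Y)
    (incl_Gamma XY) (@incl_Gamma_homo k X Y XY).

HB.instance Definition _ r (r0 : 0 < r) k X :=
  Order.isOrderMorphism.Build tree_display (Gamma k X) tree_display (Gamma k X)
    (@shift_Gamma r r0 k X) (@shift_Gamma_homo r r0 k X).

HB.instance Definition _ r (r0 : 0 < r) k X Y (theta : interleaving r k X Y) :=
  Order.isOrderMorphism.Build tree_display (Gamma k Y) tree_display (Gamma k X)
    (interleaving_Gamma r0 theta) (interleaving_Gamma_homo r0 theta).

Definition alpha k X : {omorphism Br k X -> Gamma k X} :=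
  (val : Br k X -> Gamma k X).

Definition incl_Br k X Y (XY : (X `<=` Y)%fset) : {omorphism Br k X -> Br k Y} :=
  @max_branch R Z k Y \o incl_Gamma XY \o @alpha k X.

Definition shift_Br r (r0 : 0 < r) k X : {omorphism Br k X -> Br k X} :=
  @max_branch R Z k X \o @shift_Gamma r r0 k X \o @alpha k X.

Definition interleaving_Br r (r0 : 0 < r) k X Y (theta : interleaving r k X Y) :
    {omorphism Br k Y -> Br k X} :=
  @max_branch R Z k X \o interleaving_Gamma r0 theta \o @alpha k Y.

End TreeMaps.

Definition poset_homotopic d d' (P : porderType d) (Q : porderType d')
    (f g : {omorphism P -> Q}) : Prop :=
  (forall p, (f p <= g p)%O) \/ (forall p, (g p <= f p)%O).

(** * Distances between sets of tuples *)

Section Hausdorff.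
Context {R : realType} {Z : metricType R}.

Definition distinct_tuples (n : nat) (X : {fset Z}) : set (n.-tuple Z) :=
  [set z | uniq z /\ all (fun x => x \in X) z].

Definition tuple_dist (n : nat) (z w : n.-tuple Z) : R :=
  \big[Num.max/0]_(j < n) mdist (tnth z j) (tnth w j).

(** [+oo] if exactly one of the sets is empty. *)
Definition hausdorff_dist (T : Type) (d : T -> T -> R) (A B : set T) : \bar R :=
  maxe (ereal_sup [set ereal_inf [set (d a b)%:E | b in B] | a in A])
       (ereal_sup [set ereal_inf [set (d a b)%:E | a in A] | b in B]).

End Hausdorff.

Arguments distinct_tuples {R Z} n X.
Arguments tuple_dist {R Z} n z w.

(* Main.v *)
Require Import Defs.
From mathcomp Require Import all_boot all_order all_algebra finmap.
From mathcomp Require Import all_classical all_reals.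
From mathcomp Require Import ereal topology normedtype.
From mathcomp Require Import lra.

Import Order.TTheory GRing.Theory Num.Theory.
Import numFieldTopology.Exports numFieldNormedType.Exports.

Local Open Scope classical_set_scope.
Local Open Scope ring_scope.

(** A map [L_s(Y) -> L_(s+2r)(X)] is obtained by moving every vertex [y] of
    [L_s(Y)] by less than [r] to a vertex of [L_(s+2r)(X)]. A vertex of [L_s(Y)]
    and [k] of its neighbours form a tuple of [k + 1] distinct points of [Y]; the
    bound on the Hausdorff distance gives a tuple of distinct points of [X] which
    is less than [r] away from it, and the point matched with [y] has the [k]
    other points at distance at most [s + 2 r] ([ex_close_vertex]). Vertices of
    [L_s(X)] are left in place.

    Moving points by less than [r] increases distances by less than [2 r], so
    that any such choice is a simplicial map; it is contiguous to the inclusion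
    after composition with [L_(s+2r)(X) -> L_(s+2r)(Y)], and contiguous maps are
    homotopic by straight lines, rel the points where they agree
    ([contiguous_homotopic_rel]). The choices for different [s] are unrelated,
    but two images of [y] are less than [2 r] apart, hence joined by an edge as
    soon as both are vertices: this is naturality on path components
    ([ex_interleaving]).

    On the trees, [theta i] and [i theta] are equal to the shift
    ([interleaving_incl_Gamma], [incl_interleaving_Gamma]). Maximal branch points
    lie below, so, for example, [theta (max (i b)) <= theta (i b) = sigma b],
    and applying [max], which is monotone, gives [theta_* i_* <= sigma_*]. In the
    same way [i_* theta_* <= sigma_*]. This last step holds for every system of
    interleaving maps. *)

(** * Straight-line homotopies in realizations *)

(** Along a homotopy, each point traces a path. *)
Lemma homotopic_rel_path_joined {R : realType} {S T : topologicalType}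
    {A D : set S} {B : set T} {f g : S -> T} {p : S} :
  homotopic_rel R A D B f g -> D p -> path_joined R B (f p) (g p).
Proof.
move=> [H [cH HB H01 _]] Dp; have [H0 H1] := H01 _ Dp.
exists (fun t => H (p, t)); split=> //; last by move=> t t01; exact: HB.
apply/subspace_continuousP => t t01.
have /subspace_continuousP/(_ (p, t) (conj Dp t01)) cHt := cH.
apply: (@cvg_comp _ _ _ (fun t => (p, t)) H _
  (within (D `*` `[0, 1]) (nbhs (p, t)))); last exact: cHt.
have ct : (p, t') @[t' --> t] --> (p, t).
  have cp : p @[_ --> t] --> p by exact: cvg_cst.
  exact: (cvg_pair cp cvg_id).
move=> U /= /ct; rewrite /within /= nbhs_simpl /=.
by apply: filterS => t' Ut' t'01; exact: Ut'.
Qed.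

Section Realization.
Context {R : realType} {V : choiceType}.
Implicit Types (K : scomplex V) (f g : V -> V) (sigma tau : {fset V}).
Implicit Types (w : {ptws V -> R}).

(** The closed simplex spanned by [sigma], in barycentric coordinates. *)
Definition closed_simplex sigma : set {ptws V -> R} :=
  [set w | [/\ forall v, 0 <= w v, forall v, v \notin sigma -> w v = 0
             & \sum_(v <- sigma) w v = 1]].

(** The point at time [t] of the segment from [w] to [w']. *)
Definition segment (w w' : {ptws V -> R}) (t : R) : {ptws V -> R} :=
  fun v => (1 - t) * w v + t * w' v.

Lemma closed_simplexS {sigma tau w} : (sigma `<=` tau)%fset ->
  closed_simplex sigma w -> closed_simplex tau w.
Proof.
move=> st [w0 wout w1]; split => //.
  by move=> v vt; apply: wout; apply: contra vt; exact: (fsubsetP st).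
by rewrite -w1; apply/esym/(big_fset_incl _ st) => v _ vs; exact: wout.
Qed.

Lemma segment_closed_simplex {sigma w w'} (t : R) : 0 <= t <= 1 ->
  closed_simplex sigma w -> closed_simplex sigma w' ->
  closed_simplex sigma (segment w w' t).
Proof.
move=> /andP[t0 t1] [w0 wout w1] [w'0 w'out w'1]; split.
- by move=> v; rewrite addr_ge0 ?mulr_ge0 ?subr_ge0.
- by move=> v vs; rewrite /segment wout// w'out// !mulr0 addr0.
- by rewrite big_split/= -!mulr_sumr w1 w'1 !mulr1 subrK.
Qed.

Lemma segment0 w w' : segment w w' 0 = w.
Proof. by apply/funext => v; rewrite /segment subr0 mul1r mul0r addr0. Qed.

Lemma segment1 w w' : segment w w' 1 = w'.
Proof. by apply/funext => v; rewrite /segment subrr mul1r mul0r add0r. Qed.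

Lemma segment_id w (t : R) : segment w w t = w.
Proof. by apply/funext => v; rewrite /segment -mulrDl subrK mul1r. Qed.

Lemma continuous_ptws (T : topologicalType) (f : T -> {ptws V -> R}) :
  (forall v, continuous (fun x => f x v : R)) -> continuous f.
Proof.
move=> cf x; have FF : Filter (f @ nbhs x) by exact: fmap_filter.
by refine (ptws_cvg FF _) => v; exact: cf.
Qed.

Lemma segment_continuous (T : topologicalType) (f g : T -> {ptws V -> R})
    (h : T -> R) : continuous f -> continuous g -> continuous h ->
  continuous (fun x => segment (f x) (g x) (h x)).
Proof.
move=> cf cg ch; apply: continuous_ptws => v x.
have cev (e : T -> {ptws V -> R}) : continuous e ->
    e y v @[y --> x] --> e x v.
  move=> ce; exact: (cvg_comp e (fun w : {ptws V -> R} => w v) (ce x)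
    (@proj_continuous V (fun=> R) v (e x))).
apply: cvgD; apply: cvgM; [|exact: cev|exact: ch|exact: cev].
by apply: cvgB; [exact: cvg_cst|exact: ch].
Qed.

Lemma vertex_point_closed_simplex sigma x :
  x \in sigma -> closed_simplex sigma (vertex_point x).
Proof.
move=> xs; apply: (@closed_simplexS [fset x]%fset); first by rewrite fsub1set.
split.
- by move=> v; rewrite /vertex_point ler0n.
- by move=> v; rewrite inE /vertex_point => /negbTE ->.
- by rewrite big_seq_fset1 /vertex_point eqxx.
Qed.

(** The two ends of an edge lie in the same path component. *)
Lemma edge_component {K x y} : [fset x; y]%fset \in simplices K ->
  component (R := R) K x = component K y.
Proof.
move=> xyK; apply: path_component_eq.
exists (segment (vertex_point x) (vertex_point y)); split.
- apply: continuous_subspaceT; apply: segment_continuous.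
  + by move=> ?; exact: cvg_cst.
  + by move=> ?; exact: cvg_cst.
  + by move=> ?; exact: cvg_id.
- move=> t t01; exists [fset x; y]%fset => //.
  by apply: segment_closed_simplex => //;
    apply: vertex_point_closed_simplex; rewrite !inE eqxx ?orbT.
- exact: segment0.
- exact: segment1.
Qed.

Lemma realize_closed_simplex {K f sigma w} : sigma \in simplices K ->
  closed_simplex sigma w -> closed_simplex (f @` sigma)%fset (realize R K f w).
Proof.
move=> sK [w0 wout w1]; have sub := simplex_vertices sK.
have realizeE u : realize R K f w u = \sum_(v <- sigma | f v == u) w v.
  rewrite /realize big_mkcond [RHS]big_mkcond /=.
  by apply/esym/(big_fset_incl _ sub) => v _ /wout ->; rewrite if_same.
split.
- by move=> u; rewrite realizeE; apply: sumr_ge0.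
- move=> u uf; rewrite realizeE big_seq_cond big1// => v /andP[vs /eqP fvu].
  by rewrite -fvu in_imfset in uf.
- under eq_bigr do rewrite realizeE.
  rewrite -[RHS]w1 (exchange_big_dep predT)//= big_seq [RHS]big_seq.
  apply: eq_bigr => v vs.
  have fvs : f v \in (f @` sigma)%fset by rewrite in_imfset.
  rewrite big_mkcond (big_fsetD1 (f v))//= eqxx big1_fset ?addr0//.
  by move=> u; rewrite !inE eq_sym => /andP[/negbTE -> _].
Qed.

Lemma eq_realize {K0 K f g w} : {in vertices K0, f =1 g} ->
  realization R K0 w -> realize R K f w = realize R K g w.
Proof.
move=> fg [sigma sK [_ wout _]]; apply/funext => u.
rewrite /realize big_mkcond [RHS]big_mkcond; apply: eq_bigr => v _.
have [vs|/wout ->] := boolP (v \in sigma); last by rewrite !if_same.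
by rewrite fg// (fsubsetP (simplex_vertices sK)).
Qed.

(** Contiguous simplicial maps are homotopic by the straight-line homotopy,
    which is constant wherever the two maps agree. Here [K0] need not be a
    subcomplex of [K]. *)
Lemma contiguous_homotopic_rel K0 K K' f g :
  (forall sigma, sigma \in simplices K ->
     (f @` sigma `|` g @` sigma)%fset \in simplices K') ->
  {in vertices K0, f =1 g} ->
  homotopic_rel R (realization R K0) (realization R K) (realization R K')
    (realize R K f) (realize R K g).
Proof.
move=> fgK fg; exists (fun p => segment (realize R K f p.1) (realize R K g p.1) p.2).
split.
- apply: continuous_subspaceT; apply: segment_continuous.
  + by move=> p; apply: continuous_comp; [exact: cvg_fst|exact: realize_continuous].
  + by move=> p; apply: continuous_comp; [exact: cvg_fst|exact: realize_continuous].
  + by move=> p; exact: cvg_snd.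
- move=> w t [sigma sK ws] t01; exists (f @` sigma `|` g @` sigma)%fset.
    exact: fgK.
  apply: segment_closed_simplex => //.
    exact: closed_simplexS (fsubsetUl _ _) (realize_closed_simplex sK ws).
  exact: closed_simplexS (fsubsetUr _ _) (realize_closed_simplex sK ws).
- by move=> w _; rewrite /= segment0 segment1.
- by move=> w t wK0 _; rewrite /= -(eq_realize fg wK0) segment_id.
Qed.

End Realization.

(** * Approximation of degree Rips complexes *)

Section DegreeRipsApprox.
Context {R : realType} {Z : metricType R}.
Implicit Types (s t r : R) (k : nat) (X Y : {fset Z}).

Lemma vertices_degree_ripsP s k X x :
  reflect [/\ x \in X, 0 <= s & (k <= #|` neighbors s X x|)%N]
          (x \in vertices (degree_rips s k X)).
Proof.
apply: (iffP idP).
  move=> /verticesP /degree_rips_simplicesP[]; rewrite fsub1set => xX _ xd xk.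
  by split; rewrite ?xk ?inE// -(mdistxx x) xd ?inE.
move=> [xX s0 xk]; apply/verticesP/degree_rips_simplicesP; split.
- by rewrite fsub1set.
- by apply/fset0Pn; exists x; rewrite inE.
- by move=> y z /fset1P -> /fset1P ->; rewrite mdistxx.
- by move=> y /fset1P ->.
Qed.

(** A degree Rips simplex is a non-empty set of small diameter whose points are
    all vertices: the degree condition is a condition on vertices only. *)
Lemma degree_rips_simplex s k X (sigma : {fset Z}) : sigma != fset0 ->
  (forall x, x \in sigma -> x \in vertices (degree_rips s k X)) ->
  (forall x y, x \in sigma -> y \in sigma -> mdist x y <= s) ->
  sigma \in simplices (degree_rips s k X).
Proof.
move=> s0 sV sd; apply/degree_rips_simplicesP; split => //.
  by apply/fsubsetP => x /sV /vertices_degree_ripsP[].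
by move=> x /sV /vertices_degree_ripsP[].
Qed.

Lemma degree_rips_edge s k X x y : x \in vertices (degree_rips s k X) ->
  y \in vertices (degree_rips s k X) -> mdist x y <= s ->
  [fset x; y]%fset \in simplices (degree_rips s k X).
Proof.
move=> xV yV xy; have s0 : 0 <= s by exact: le_trans (mdist_ge0 x y) xy.
apply: degree_rips_simplex.
- by apply/fset0Pn; exists x; rewrite !inE eqxx.
- by move=> z /fset2P[] ->.
- by move=> a b /fset2P[] -> /fset2P[] ->; rewrite ?mdistxx// metric_sym.
Qed.

Lemma hausdorff_dist_lt {T : Type} {d : T -> T -> R} {A B : set T} {r b} :
  (hausdorff_dist d A B < r%:E)%E -> B b -> exists2 a, A a & d a b < r.
Proof.
rewrite /hausdorff_dist gt_max => /andP[_ dr] Bb.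
have : (ereal_inf [set (d a b)%:E | a in A] < r%:E)%E.
  by apply: le_lt_trans dr; apply: ereal_sup_ubound; exists b.
by move=> /ereal_inf_lt[_ [a Aa <-]]; rewrite lte_fin; exists a.
Qed.

(** A vertex [y] with [k] neighbours is a tuple of [k + 1] distinct points; in a
    close tuple of distinct points, the one matched with [y] has the others as
    neighbours. *)
Lemma ex_close_vertex {r k X Y s y} :
  (hausdorff_dist (tuple_dist k.+1) (distinct_tuples k.+1 X)
     (distinct_tuples k.+1 Y) < r%:E)%E -> 0 <= s + 2 * r ->
  y \in vertices (degree_rips s k Y) ->
  exists2 x, x \in vertices (degree_rips (s + 2 * r) k X) & mdist x y < r.
Proof.
move=> dH sr0 /vertices_degree_ripsP[yY s0 yk].
pose nb := take k (enum_fset (neighbors s Y y)).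
have nbP z : z \in nb -> z \in neighbors s Y y by move/mem_take.
have snb : size nb = k by rewrite size_take_min (minn_idPl yk).
have synb : size (y :: nb) == k.+1 by rewrite /= snb.
have [|z [uz zX] dz] := hausdorff_dist_lt (b := Tuple synb) dH.
  split; last by rewrite /= yY; apply/allP => z /nbP; rewrite !inE => /andP[].
  rewrite /= take_uniq ?fset_uniq// andbT.
  by apply/negP => /nbP; rewrite !inE eqxx andbF.
have {}dz j : mdist (tnth z j) (tnth (Tuple synb) j) < r.
  by move/bigmax_ltP : dz => [_]; apply.
case/tupleP: z => x u in uz zX dz.
have /andP[xu uu] : (x \notin u) && uniq u := uz.
have /andP[xX uX] : (x \in X) && all (fun x => x \in X) u := zX.
have dxy : mdist x y < r by exact: (dz ord0).
exists x => //; apply/vertices_degree_ripsP; split => //.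
apply: (@leq_trans (size u)); first by rewrite size_tuple.
apply: uniq_leq_size => // a au; have [j ja] := tnthP _ _ au.
pose b := tnth (Tuple synb) (lift ord0 j).
have /nbP : b \in nb.
  by rewrite /b (tnth_nth y)/= mem_nth// snb; exact: ltn_ord.
have : mdist a b < r by have := dz (lift ord0 j); rewrite tnthS -ja.
rewrite metric_sym !inE (allP uX)// (memPn xu)//= => dba /and3P[_ _ dyb].
have := metric_triangle x y a; have := metric_triangle y b a; lra.
Qed.

(** A choice of close vertices, which keeps the vertices of the complexes of [X]
    in place, is a system of interleaving maps. *)
Lemma ex_interleaving {r k X Y} : (X `<=` Y)%fset -> 0 < r ->
  (hausdorff_dist (tuple_dist k.+1) (distinct_tuples k.+1 X)
     (distinct_tuples k.+1 Y) < r%:E)%E ->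
  exists theta : interleaving r k X Y, forall s y, 0 <= s ->
    y \in vertices (degree_rips s k Y) -> mdist (theta s y) y < r.
Proof.
move=> XY r0 dH.
(* p is a pair (s, y): the choice is made independently for each height s *)
pose close_to (p : R * Z) x := 0 <= p.1 ->
  (p.2 \in vertices (degree_rips p.1 k Y) ->
    x \in vertices (degree_rips (p.1 + 2 * r) k X) /\ mdist x p.2 < r) /\
  (p.2 \in vertices (degree_rips p.1 k X) -> x = p.2).
have [|theta thetaP] := @choice _ _ close_to.
  move=> [s y]; rewrite /close_to /=.
  have [yX|yX] := boolP (y \in vertices (degree_rips s k X)).
    exists y => s0; split=> // _; rewrite mdistxx; split => //.
    exact: simplicial_map_vertices (degree_rips_incl (shift_ge s r0) (fsubset_refl X)) yX.
  have [yY|yY] := boolP (y \in vertices (degree_rips s k Y)); last by exists y.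
  have sr0 : 0 <= s + 2 * r by have /vertices_degree_ripsP[] := yY; lra.
  by have [x ? ?] := ex_close_vertex dH sr0 yY; exists x.
have thetaV s y : 0 <= s -> y \in vertices (degree_rips s k Y) ->
    theta (s, y) \in vertices (degree_rips (s + 2 * r) k X).
  by move=> s0 /(thetaP (s, y) s0).1[].
have thetaD s y : 0 <= s -> y \in vertices (degree_rips s k Y) ->
    mdist (theta (s, y)) y < r.
  by move=> s0 /(thetaP (s, y) s0).1[].
have thetaX s y : 0 <= s -> y \in vertices (degree_rips s k X) -> theta (s, y) = y.
  by move=> s0 /(thetaP (s, y) s0).2.
have thetaS s : 0 <= s -> simplicial_map (degree_rips s k Y)
    (degree_rips (s + 2 * r) k X) (fun y => theta (s, y)).
  move=> s0 sigma sK; have sV := fsubsetP (simplex_vertices sK).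
  have /degree_rips_simplicesP[_ /fset0Pn[y0 y0s] sd _] := sK.
  apply: degree_rips_simplex.
  - by apply/fset0Pn; exists (theta (s, y0)); rewrite in_imfset.
  - by move=> _ /imfsetP[y /= /sV yV ->]; exact: thetaV.
  - move=> _ _ /imfsetP[y /= ys ->] /imfsetP[z /= zs ->].
    have := sd _ _ ys zs.
    have := thetaD _ _ s0 (sV _ ys); have := thetaD _ _ s0 (sV _ zs).
    have := metric_triangle (theta (s, y)) y (theta (s, z)).
    have := metric_triangle y z (theta (s, z)).
    rewrite (metric_sym z); lra.
unshelve eexists (@Interleaving R Z r k X Y (fun s y => theta (s, y)) thetaS _ _ _).
- by move=> s x; exact: thetaX.
- move=> s s0; apply: contiguous_homotopic_rel; last first.
    by move=> x; exact: thetaX.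
  move=> sigma sK; have sV := fsubsetP (simplex_vertices sK).
  have /degree_rips_simplicesP[_ /fset0Pn[y0 y0s] sd _] := sK.
  rewrite imfset_id; apply: degree_rips_simplex.
  - by apply/fset0Pn; exists y0; rewrite inE y0s orbT.
  - move=> z; rewrite inE => /orP[/imfsetP[y /= /sV yV ->]|/sV zV].
      exact: simplicial_map_vertices (degree_rips_incl (lexx _) XY) (thetaV _ _ s0 yV).
    exact: simplicial_map_vertices (degree_rips_incl (shift_ge s r0) (fsubset_refl Y)) zV.
  - (* every point of the union is less than r away from a point of sigma *)
    have near z : z \in ((fun y => theta (s, y)) @` sigma `|` sigma)%fset ->
        exists2 y, y \in sigma & mdist z y < r.
      rewrite inE => /orP[/imfsetP[y /= ys ->]|zs].
        by exists y => //; exact: thetaD (sV _ ys).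
      by exists z => //; rewrite mdistxx.
    move=> a b /near[y ys ay] /near[z zs bz]; have := sd _ _ ys zs.
    have := metric_triangle a y b; have := metric_triangle y z b.
    rewrite (metric_sym z); lra.
- move=> s t C s0 st [y yV <-]; have t0 := le_trans s0 st.
  have tV := simplicial_map_vertices (degree_rips_incl st (fsubset_refl Y)) yV.
  have str : s + 2 * r <= t + 2 * r by rewrite lerD2r.
  have strK := degree_rips_incl (k := k) str (fsubset_refl X).
  rewrite (pi0_mapE (thetaS s s0) yV) (pi0_mapE strK (thetaV _ _ s0 yV)).
  rewrite (pi0_mapE (degree_rips_incl st (fsubset_refl Y)) yV).
  rewrite (pi0_mapE (thetaS t t0) tV); apply: edge_component.
  apply: degree_rips_edge; [|exact: thetaV|].
    exact: simplicial_map_vertices strK (thetaV _ _ s0 yV).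
  have := thetaD _ _ s0 yV; have := thetaD _ _ t0 tV.
  have := metric_triangle (theta (s, y)) y (theta (t, y)).
  rewrite (metric_sym y); lra.
- by move=> s y; exact: thetaD.
Qed.

End DegreeRipsApprox.

(** * Comparison of the trees *)

Section InterleavingTree.
Context {R : realType} {Z : metricType R} (r : R) (r0 : 0 < r) (k : nat).
Context (X Y : {fset Z}) (XY : (X `<=` Y)%fset) (theta : interleaving r k X Y).

(** [theta i = sigma] on the trees. *)
Lemma interleaving_incl_Gamma (g : Gamma k X) :
  interleaving_Gamma r0 theta (incl_Gamma XY g) = shift_Gamma r0 g.
Proof.
apply: Gamma_eq => //=; case: (classP g) => x xV <-.
have h0 := height_ge0 g; have inclK := degree_rips_incl (k := k) (lexx (height g)) XY.
rewrite (pi0_mapE inclK xV) pi0_mapE ?(imap_incl theta)//.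
- by rewrite (pi0_mapE (degree_rips_incl (shift_ge _ r0) (fsubset_refl X)) xV).
- exact: imap_simplicial.
- exact: simplicial_map_vertices inclK xV.
Qed.

(** [i theta = sigma] on the trees: the homotopy from [i theta] to the inclusion
    joins the images of each vertex by a path. *)
Lemma incl_interleaving_Gamma (g : Gamma k Y) :
  incl_Gamma XY (interleaving_Gamma r0 theta g) = shift_Gamma r0 g.
Proof.
apply: Gamma_eq => //=; case: (classP g) => y yV <-.
have h0 := height_ge0 g; have thetaK := imap_simplicial theta h0.
have shiftK := degree_rips_incl (k := k) (shift_ge (height g) r0) (fsubset_refl Y).
rewrite (pi0_mapE thetaK yV).
rewrite pi0_mapE; last 2 first.
- exact: degree_rips_incl.
- exact: simplicial_map_vertices thetaK yV.
rewrite (pi0_mapE shiftK yV); apply: path_component_eq.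
have := homotopic_rel_path_joined (imap_homotopic theta h0)
  (realization_vertex (R := R) yV).
by rewrite !realize_vertex.
Qed.

Lemma interleaving_incl_Br :
  poset_homotopic (interleaving_Br r0 theta \o incl_Br k XY) (shift_Br r0 k X).
Proof.
left => b; rewrite /interleaving_Br /incl_Br /shift_Br /= -interleaving_incl_Gamma.
apply/max_branch_homo/interleaving_Gamma_homo.
by have [] := max_branchP (incl_Gamma XY (alpha k X b)).
Qed.

Lemma incl_interleaving_Br :
  poset_homotopic (incl_Br k XY \o interleaving_Br r0 theta) (shift_Br r0 k Y).
Proof.
left => b; rewrite /interleaving_Br /incl_Br /shift_Br /= -incl_interleaving_Gamma.
apply/max_branch_homo/incl_Gamma_homo.
by have [] := max_branchP (interleaving_Gamma r0 theta (alpha k Y b)).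
Qed.

End InterleavingTree.

Theorem theorem2 (R : realType) (Z : metricType R) (X Y : {fset Z})
    (XY : (X `<=` Y)%fset) (k : nat) (r : R) (r0 : 0 < r)
    (LX_neq0 : \forall s \near +oo, simplices (degree_rips (s : R) k X) != fset0)
    (LY_neq0 : \forall s \near +oo, simplices (degree_rips (s : R) k Y) != fset0)
    (dH_lt : (hausdorff_dist (tuple_dist k.+1) (distinct_tuples k.+1 X)
                (distinct_tuples k.+1 Y) < r%:E)%E) :
  exists theta : interleaving r k X Y,
    poset_homotopic (interleaving_Br r0 theta \o incl_Br k XY) (shift_Br r0 k X) /\
    poset_homotopic (incl_Br k XY \o interleaving_Br r0 theta) (shift_Br r0 k Y).
Proof.
have [theta _] := ex_interleaving XY r0 dH_lt; exists theta.
by split; [exact: interleaving_incl_Br|exact: incl_interleaving_Br].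
Qed.
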